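(* Let $1<r<2$, $m\ge1$, and put $\sigma_m=\frac{m-1}m\big(1-\frac1r\big)$. Let $p=(p_k)_k$ be the increasing sequence of prime numbers. Then for every $\varepsilon>\frac1r$, $$\frac1{p^{\sigma_m}(\log p)^{\varepsilon}}\cdot\ell_r\subset\mathrm{mon}\,\mathcal P(^m\ell_r).$$ In particular, for all $\varepsilon>0$, $$\frac1{p^{\sigma_m+\varepsilon}}\cdot\ell_r\subset\mathrm{mon}\,\mathcal P(^m\ell_r).$$
   Context: For a sequence $a=(a_k)_k$, $a\cdot\ell_r=\{(a_ku_k)_k:u\in\ell_r\}$; here $\frac1{p^{\sigma_m}(\log p)^\varepsilon}$ denotes the sequence $\big(p_k^{-\sigma_m}(\log p_k)^{-\varepsilon}\big)_k$ and $\frac{1}{p^{\sigma_m+\varepsilon}}$ the sequence $(p_k^{-\sigma_m-\varepsilon})_k$. $\mathcal P(^m\ell_r)$ is the space of bounded $m$-homogeneous polynomials on complex $\ell_r$. $\mathcal J(m)=\{\mathbf j=(j_1,\dots,j_m)\in\mathbb N^m:j_1\le\dots\le j_m\}$, $z_{\mathbf j}=z_{j_1}\cdots z_{j_m}$, and $c_{\mathbf j}(P)$ are the unique scalars with $P(z)=\sum_{\mathbf j\in\mathcal J(m)}c_{\mathbf j}(P)z_{\mathbf j}$ for finitely supported $z$. The set of monomial convergence is $\mathrm{mon}\,\mathcal P(^m\ell_r)=\{z\in\ell_r:\sum_{\mathbf j\in\mathcal J(m)}|c_{\mathbf j}(P)z_{\mathbf j}|<\infty\text{ for all }P\in\mathcal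 P(^m\ell_r)\}$. *)

(* Defs.v *)
From HB Require Import structures.
From mathcomp Require Import all_boot all_order all_algebra.
From mathcomp Require Import complex.
From mathcomp Require Import all_classical all_reals all_analysis.

Set Implicit Arguments.
Unset Strict Implicit.
Unset Printing Implicit Defensive.

Import Order.TTheory GRing.Theory Num.Theory.

Local Open Scope classical_set_scope.
Local Open Scope ring_scope.

Definition Jset (m : nat) : set (m.-tuple nat) := [set j | sorted leq j].
Arguments Jset : clear implicits.

Section Definitions.
Variable R : realType.
Local Notation C := R[i].
Local Notation cseq := (nat -> C).

Definition lr_norm (r : R) (u : cseq) : \bar R :=
  ('N[counting]_(r%:E)[EFin \o (@Normc.normc R \o u)])%E.

Definition ell (r : R) : set cseq := [set u | (lr_norm r u < +oo)%E].

(* The diagonal multiplication a . E, for a weight sequence a of real numbers. *)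
Definition scaled (a : nat -> R) (E : set cseq) : set cseq :=
  [set (fun k => (a k)%:C%C * u k) | u in E].

(* m-linearity of a form on a set E of sequences (E will be a linear subspace);
   the values of A at arguments outside E are irrelevant. *)
Definition multilinear_on (E : set cseq) (m : nat) (A : ('I_m -> cseq) -> C) :=
  forall (x : 'I_m -> cseq) (i : 'I_m) (a : C) (u v : cseq),
    (forall j, E (x j)) -> E u -> E v ->
    A (dfwith x i (fun k => a * u k + v k)) =
    a * A (dfwith x i u) + A (dfwith x i v).

(* Scalar functions whose restriction to ell_r is a bounded m-homogeneous
   polynomial; only that restriction matters in the sequel. *)
Definition hpoly (r : R) (m : nat) : set (cseq -> C) :=
  [set P | (exists2 A : ('I_m -> cseq) -> C, multilinear_on (ell r) A &
              forall x, ell r x -> P x = A (fun=> x))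
         /\ (exists M : R, forall x, (lr_norm r x <= 1)%E ->
              Normc.normc (P x) <= M)].

Definition mono (z : cseq) (m : nat) (j : m.-tuple nat) : C :=
  \prod_(k <- j) z k.

Definition finsupp_seq (z : cseq) := exists n, forall k, (n <= k)%N -> z k = 0.

(* For m > 0 and z finitely supported, the sum has finitely many nonzero
   terms, so that the finitely supported sum \sum_(_ \in _) is meaningful. *)
Definition monomial_expansion (m : nat) (P : cseq -> C)
    (c : m.-tuple nat -> C) :=
  forall z, finsupp_seq z -> P z = \sum_(j \in Jset m) c j * mono z j.

(* Existence and uniqueness on Jset m are hpoly_mcoefP and hpoly_mcoef_uniq. *)
Definition mcoef (m : nat) (P : cseq -> C) : m.-tuple nat -> C :=
  xget (fun=> 0) [set c | monomial_expansion P c].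

Definition mon (r : R) (m : nat) : set cseq :=
  [set z | ell r z /\ forall P, hpoly r m P ->
     (\esum_(j in Jset m) (Normc.normc (mcoef P j * mono z j))%:E < +oo)%E].

End Definitions.

Section CoefficientsWellDefined.
Variable R : realType.
Local Notation C := R[i].
Local Notation cseq := (nat -> C).

Fixpoint words (n d : nat) : seq (seq nat) :=
  if d is d'.+1 then [seq rcons t k | t <- words n d', k <- iota 0 n]
  else [:: [::]].

Lemma mem_words n d (t : seq nat) :
  (t \in words n d) = (size t == d) && all (fun k => k < n)%N t.
Proof.
elim: d t => [|d IH] t /=.
  by rewrite inE size_eq0; case: eqP => [->|].
apply/allpairsP/idP => [[[s k] /= []]|].
  rewrite IH mem_iota add0n => /andP[/eqP ss sn] kn ->.
  by rewrite size_rcons ss eqxx all_rcons sn andbT.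
case: (lastP t) => [|s k] //; rewrite size_rcons eqSS all_rcons => /andP[ss].
case/andP=> kn sn; exists (s, k); split => //=; first by rewrite IH ss.
by rewrite mem_iota add0n.
Qed.

Lemma uniq_words n d : uniq (words n d).
Proof.
elim: d => [//|d IH] /=; apply: allpairs_uniq; rewrite ?iota_uniq//.
by move=> [s k] [s' k'] _ _ /= /rcons_inj[-> ->].
Qed.

Lemma finsupp_ell (r : R) (z : cseq) : 0 < r -> finsupp_seq z -> ell r z.
Proof.
move=> r0 [n zn]; rewrite /ell /= /lr_norm Lnorm_counting//.
apply: poweR_lty; rewrite (nneseries_split 0 n) => [|k _]; last exact: poweR_ge0.
rewrite add0n eseries0 ?adde0 => [|k nk _].
  apply: lte_sum_pinfty => k _; apply: poweR_lty; exact: ltry.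
by rewrite /comp zn// Normc.normc0 abse0 poweR0r// gt_eqF.
Qed.

Section Existence.
Variables (r : R) (m : nat) (A : ('I_m -> cseq) -> C).
Hypotheses (r0 : 0 < r) (mA : multilinear_on (ell r) A).

Let e (k : nat) : cseq := fun l => (l == k)%:R.

Let fe k : finsupp_seq (e k).
Proof. by exists k.+1 => l; rewrite /e; case: eqP => // ->; rewrite ltnn. Qed.

Let expand1 (x : 'I_m -> cseq) i n (z : cseq) :
  (forall j, finsupp_seq (x j)) -> (forall k, (n <= k)%N -> z k = 0) ->
  A (dfwith x i z) = \sum_(k <- iota 0 n) z k * A (dfwith x i (e k)).
Proof.
move=> fx; have ex j := finsupp_ell r0 (fx j).
have A0 : A (dfwith x i (fun=> 0)) = 0.
  have z0 : ell r (fun=> 0 : C) by apply: finsupp_ell => //; exists 0%N.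
  have := mA i 1 ex z0 z0.
  have -> : (fun k : nat => 1 * 0 + 0 : C) = (fun=> 0).
    by apply/funext => k; rewrite mulr0 addr0.
  by rewrite mul1r => /eqP; rewrite -subr_eq0 opprD addNKr oppr_eq0 => /eqP.
elim: n z => [|n IH] z zn.
  by rewrite big_nil; have -> : z = (fun=> 0) by apply/funext => k; rewrite zn.
rewrite -addn1 iotaD big_cat big_seq1 add0n /=.
pose z' k := if (k < n)%N then z k else 0.
have z'n k : (n <= k)%N -> z' k = 0 by rewrite /z' ltnNge => ->.
have zE : z = (fun k => z n * e n k + z' k).
  apply/funext => k; rewrite /e /z'; case: (ltngtP k n) => [kn|nk|->].
  - by rewrite mulr0 add0r.
  - by rewrite mulr0 addr0 zn.
  - by rewrite mulr1 addr0.
rewrite {1}zE mA//; last 2 first.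
- exact: finsupp_ell.
- by apply: finsupp_ell => //; exists n.
rewrite addrC (IH z' z'n); congr (_ + _).
by apply: eq_big_seq => k; rewrite mem_iota add0n /= /z' => ->.
Qed.

Let pref d (t : seq nat) (z : cseq) : 'I_m -> cseq :=
  fun i => if (i < d)%N then e (nth 0%N t i) else z.

Let expand n (z : cseq) d : (forall k, (n <= k)%N -> z k = 0) -> (d <= m)%N ->
  A (fun=> z) = \sum_(t <- words n d) (\prod_(k <- t) z k) * A (pref d t z).
Proof.
move=> zn; elim: d => [|d IH] dm.
  by rewrite /= big_seq1 big_nil mul1r; congr A.
rewrite IH 1?ltnW//= big_allpairs_dep /=; apply: eq_big_seq => t.
rewrite mem_words => /andP[/eqP st _].
pose i := Ordinal dm.
have -> : pref d t z = dfwith (pref d t z) i z.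
  apply/funext => j; case: (eqVneq i j) => [<-|ij]; last by rewrite dfwithout.
  by rewrite dfwithin /pref ltnn.
rewrite (@expand1 _ _ n)//; last first.
  by move=> j; rewrite /pref; case: ifP => _; [exact: fe|exists n].
rewrite big_distrr /=; apply: eq_bigr => k _.
rewrite -cats1 big_cat big_seq1 /= mulrA; congr (_ * A _).
apply/funext => j; case: (eqVneq i j) => [<-|ij].
  by rewrite dfwithin /pref ltnSn nth_cat st ltnn subnn.
rewrite dfwithout// /pref.
have jd : (j != d :> nat) by rewrite eq_sym.
by rewrite ltnS (leq_eqVlt j) (negPf jd) /= nth_cat st; case: ifP.
Qed.

Lemma expansion_exists : exists c : m.-tuple nat -> C,
  monomial_expansion (fun z => A (fun=> z)) c.
Proof.
pose G (t : seq nat) := A (fun i => e (nth 0%N t i)).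
exists (fun j => \sum_(t <- permutations j) G t) => z [n zn].
rewrite (@expand n z m)//.
have -> : \sum_(t <- words n m) (\prod_(k <- t) z k) * A (pref m t z) =
    \sum_(t <- words n m) (\prod_(k <- t) z k) * G t.
  apply: eq_bigr => t _; congr (_ * A _); apply/funext => i.
  by rewrite /pref ltn_ord.
pose S : seq (m.-tuple nat) :=
  undup [seq j <- pmap insub (words n m) | sorted leq (tval j)].
have memS j : (j \in S) = sorted leq j && all (fun k => k < n)%N j.
  rewrite mem_undup mem_filter mem_pmap_sub mem_words size_tuple eqxx.
  by [].
rewrite (fsbigE S) ?undup_uniq//; last 2 first.
- by move=> j /=; rewrite memS => /andP[].
- move=> j Jj; rewrite memS Jj /= => /allPn[k kj]; rewrite -leqNgt => nk.
  by rewrite /mono (big_rem k)//= zn// mul0r mulr0.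
rewrite [RHS]big_seq_cond [RHS](eq_bigl (fun j => j \in S)); last first.
  move=> j; rewrite andb_idr// memS => /andP[jj _]; exact/mem_set.
rewrite -big_seq.
have -> : \sum_(t <- words n m) (\prod_(k <- t) z k) * G t =
    \sum_(t <- words n m) \sum_(j <- S | perm_eq t j) (\prod_(k <- t) z k) * G t.
  apply: eq_big_seq => t; rewrite mem_words => /andP[/eqP st tn].
  have sst : size (sort leq t) == m by rewrite size_sort st.
  pose j0 : m.-tuple nat := Tuple sst.
  have j0S : j0 \in S.
    by rewrite memS /= sort_sorted ?all_sort//; exact: leq_total.
  rewrite [RHS]big_mkcond [RHS](bigD1_seq j0) ?undup_uniq//=.
  rewrite perm_sym perm_sort perm_refl [X in _ + X]big_seq_cond [X in _ + X]big1 ?addr0// => j.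
  case/andP=> jS jj0; case: ifP => // tj.
  move: jS; rewrite memS => /andP[sj _]; case/eqP: jj0; apply: val_inj => /=.
  apply: (sorted_eq leq_trans anti_leq) => //; first exact: sort_sorted leq_total _.
  by rewrite perm_sym perm_sort.
rewrite (exchange_big_dep xpredT)//=; apply: eq_big_seq => j.
rewrite memS => /andP[sj jn]; rewrite big_distrl /= -big_filter.
rewrite (perm_big (permutations j)) /=; last first.
  apply: uniq_perm; rewrite ?filter_uniq ?uniq_words ?permutations_uniq// => t.
  rewrite mem_filter mem_permutations mem_words; case tj: (perm_eq t j) => //=.
  by rewrite (perm_size tj) size_tuple eqxx (perm_all _ tj).
apply: eq_big_seq => t; rewrite mem_permutations => tj.
by rewrite mulrC /mono (perm_big _ tj).
Qed.

End Existence.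

Let digits (b n : nat) (f g : nat -> nat) :
  (forall k, f k < b)%N -> (forall k, g k < b)%N ->
  (\sum_(0 <= k < n) f k * b ^ k = \sum_(0 <= k < n) g k * b ^ k)%N ->
  forall k, (k < n)%N -> f k = g k.
Proof.
elim: n f g => [//|n IH] f g fb gb; have b0 : (0 < b)%N by case: b fb {IH gb} => // /(_ 0%N).
have E h : (\sum_(0 <= k < n.+1) h k * b ^ k =
    (\sum_(0 <= k < n) h k.+1 * b ^ k) * b + h 0%N)%N.
  rewrite big_nat_recl// expn0 muln1 addnC big_distrl /=; congr addn.
  by apply: eq_bigr => k _; rewrite expnSr mulnA.
rewrite !E => H.
have h0 : f 0%N = g 0%N.
  by have := congr1 (modn^~ b) H; rewrite !modnMDl !modn_small.
have hS : forall k, (k < n)%N -> f k.+1 = g k.+1.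
  apply: IH => //; move: H; rewrite h0 => /addIn /eqP.
  by rewrite eqn_pmul2r// => /eqP.
by case=> [//|k]; rewrite ltnS; exact: hS.
Qed.

Lemma expansion_uniq (m : nat) (P : cseq -> C) (c c' : m.-tuple nat -> C) :
  monomial_expansion P c -> monomial_expansion P c' ->
  forall j, Jset m j -> c j = c' j.
Proof.
move=> Pc Pc' j0 Jj0; apply/eqP; rewrite -subr_eq0; apply/eqP.
pose n := (\max_(k <- j0) k).+1.
have j0n : all (fun k => k < n)%N j0.
  by apply/allP => k kj; rewrite ltnS; exact: (@leq_bigmax_seq _ _ xpredT id).
pose S : seq (m.-tuple nat) :=
  undup [seq j <- pmap insub (words n m) | sorted leq (tval j)].
have memS j : (j \in S) = sorted leq j && all (fun k => k < n)%N j.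
  rewrite mem_undup mem_filter mem_pmap_sub mem_words size_tuple eqxx.
  by [].
pose w (j : m.-tuple nat) := (\sum_(k <- j) m.+1 ^ k)%N.
pose q : {poly C} := \sum_(j <- S) (c j - c' j) *: 'X^(w j).
have q0 t : q.[t] = 0.
  pose z k := if (k < n)%N then t ^+ (m.+1 ^ k) else 0.
  have fz : finsupp_seq z by exists n => k; rewrite /z ltnNge => ->.
  have F d : \sum_(j \in Jset m) d j * mono z j = \sum_(j <- S) d j * t ^+ w j.
    rewrite (fsbigE S) ?undup_uniq//; last 2 first.
    - by move=> j /=; rewrite memS => /andP[].
    - move=> j Jj; rewrite memS Jj /= => /allPn[k kj]; rewrite /mono => nk.
      by rewrite (big_rem k)//= /z (negPf nk) mul0r mulr0.
    rewrite big_seq_cond [RHS]big_seq; apply: eq_big => j.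
      by rewrite andb_idr// memS => /andP[jj _]; exact/mem_set.
    rewrite memS => /andP[/andP[_ jn] _]; congr (_ * _).
    rewrite /mono /w (big_morph _ (exprD t) (expr0 t)).
    by apply: eq_big_seq => k /(allP jn); rewrite /z => ->.
  rewrite /q horner_sum; under eq_bigr do rewrite hornerZ hornerXn mulrBl.
  by rewrite sumrB -!F -Pc// -Pc'// subrr.
have {}q0 : q = 0.
  apply/eqP/negPn/negP => qn0.
  have := @max_poly_roots _ q [seq k%:R | k <- iota 0 (size q)] qn0.
  rewrite size_map size_iota ltnn => H; apply/notF/H.
    by apply/allP => x _; apply/rootP.
  rewrite map_inj_uniq ?iota_uniq// => k l /eqP.
  by rewrite eqr_nat => /eqP.
have /(congr1 (fun q : {poly C} => q`_(w j0))) := q0.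
rewrite /q coef_sum coef0 (bigD1_seq j0) ?undup_uniq ?memS//=; last first.
  by rewrite j0n andbT.
rewrite coefZ coefXn eqxx mulr1 big_seq_cond big1 ?addr0// => j.
rewrite memS => /andP[/andP[sj jn] /eqP jj0].
rewrite coefZ coefXn; case: eqP => [wj|]; last by rewrite mulr0.
have W (i : m.-tuple nat) : all (fun k => k < n)%N i ->
    w i = (\sum_(0 <= k < n) count_mem k i * m.+1 ^ k)%N.
  move=> in_; rewrite /w; under [RHS]eq_bigr => k _ do
    rewrite -sum1_count big_distrl /=.
  rewrite (exchange_big_dep xpredT)//=; apply: eq_big_seq => k /(allP in_) kn.
  rewrite big_mkcond /= (bigD1_seq k) ?mem_index_iota ?iota_uniq//= eqxx mul1n.
  by rewrite big1 ?addn0// => l lk; rewrite eq_sym (negPf lk).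
case: jj0; apply: val_inj; apply: (sorted_eq leq_trans anti_leq) => //.
have cl (i : m.-tuple nat) k : (count_mem k i < m.+1)%N.
  by rewrite ltnS -[X in (_ <= X)%N](size_tuple i) count_size.
have D : forall k, (k < n)%N -> count_mem k j = count_mem k j0.
  by apply: (@digits m.+1) => //; rewrite -!W.
apply/allP => k _ /=; case: (ltnP k n) => kn; first by rewrite D.
have Z (i : m.-tuple nat) : all (fun k => k < n)%N i -> count_mem k i = 0%N.
  by move=> in_; apply/count_memPn/negP => /(allP in_); rewrite ltnNge kn.
by rewrite !Z.
Qed.

Lemma hpoly_mcoefP (r : R) (m : nat) (P : cseq -> C) : 0 < r ->
  hpoly r m P -> monomial_expansion P (@mcoef R m P).
Proof.
move=> r0 [[A mA PA] _]; have [c hc] := expansion_exists r0 mA.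
suff H : monomial_expansion P c by exact: (xgetPex (fun=> 0) (ex_intro _ c H)).
by move=> z fz; rewrite PA ?hc//; exact: finsupp_ell.
Qed.

Lemma hpoly_mcoef_uniq (r : R) (m : nat) (P : cseq -> C) (c : m.-tuple nat -> C) :
  0 < r -> hpoly r m P -> monomial_expansion P c ->
  forall j, Jset m j -> c j = mcoef P j.
Proof.
by move=> r0 hP Pc; apply: expansion_uniq Pc _; exact: hpoly_mcoefP r0 hP.
Qed.

End CoefficientsWellDefined.

(* Main.v *)
(* Split a nondecreasing multi-index as j = (i, k) with i of length m - 1.
   Polarization shows that y |-> \sum_k c_(i,k) y_k, over k >= max i, is bounded
   on ell_r uniformly in i.  If z = a w with w in ell_r and a nonincreasing, this
   gives \sum_k |c_(i,k) z_k| <= K a_(max i), and by Young's inequality it remains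
   to bound \sum_i (a_i a_(max i))^r', where 1/r + 1/r' = 1.  Summing first over
   the entries of i below its maximum q, and putting beta = a^r', this sum is at
   most \sum_q beta_q^2 (\sum_(k <= q) beta_k)^(m-2), which is dominated by
   \sum_q 1 / (q ln^2 q) as soon as beta_k = O(k^(-(m-1)/m) / ln k).  Of the
   primes only the trivial bound p_k >= k + 2 (with p_0 = 2) is used. *)

Require Import Defs.
From HB Require Import structures.
From mathcomp Require Import all_boot all_order all_algebra.
From mathcomp Require Import complex.
From mathcomp Require Import all_classical all_reals all_analysis.
From mathcomp Require Import ring lra.
Import Order.TTheory GRing.Theory Num.Theory.
Local Open Scope classical_set_scope.
Local Open Scope ring_scope.

Set Implicit Arguments.
Unset Strict Implicit.
Unset Printing Implicit Defensive.

(** * Sums over nondecreasing words *)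

Section Words.
Variable R : comNzRingType.

Lemma sum_words (g : nat -> R) n d :
  \sum_(t <- words n d) \prod_(k <- t) g k = (\sum_(k <- iota 0 n) g k) ^+ d.
Proof.
elim: d => [|d IH]; first by rewrite /= big_seq1 big_nil.
rewrite /= big_allpairs_dep /= exprSr -IH big_distrl /=; apply: eq_bigr => t _.
by rewrite big_distrr /=; apply: eq_bigr => k _; rewrite big_rcons.
Qed.

Lemma sum_words_rcons (P : pred (seq nat)) (F : seq nat -> R) n d :
  \sum_(t <- words n d.+1 | P t) F t =
  \sum_(t <- words n d) \sum_(k <- iota 0 n | P (rcons t k)) F (rcons t k).
Proof.
rewrite big_mkcond /= big_allpairs_dep /=; apply: eq_bigr => t _.
by rewrite [RHS]big_mkcond.
Qed.
End Words.

Lemma path_leq_last x (t : seq nat) k :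
  path leq x t -> k \in t -> (k <= last x t)%N.
Proof.
elim/last_ind: t => [//|t q IH]; rewrite rcons_path last_rcons mem_rcons inE.
by case/andP=> pt tq /predU1P[->//|/(IH pt)/leq_trans]; exact.
Qed.

Lemma ler_sum_seq (R : numDomainType) (I : eqType) (s : seq I) (P : pred I)
    (F G : I -> R) :
  {in s, forall i, P i -> F i <= G i} ->
  \sum_(i <- s | P i) F i <= \sum_(i <- s | P i) G i.
Proof.
move=> FG; rewrite big_seq_cond [leRHS]big_seq_cond.
by apply: ler_sum => i /andP[]; exact: FG.
Qed.

(** * Summability of weight products over nondecreasing words *)

Section Summability.
Variable R : realType.
Implicit Type b : nat -> R.

(** The last letter q of a nondecreasing word is its maximum, so its weight occurs squared. Relaxing
    the order of the other letters to the bound k <= q turns the remaining sum into a power. *)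
Lemma sum_sorted_le b n d : (forall k, 0 <= b k) ->
  \sum_(t <- words n d.+1 | path leq 0 t) (\prod_(k <- t) b k) * b (last 0 t) <=
  \sum_(q <- iota 0 n) b q ^+ 2 * (\sum_(k <- iota 0 q.+1) b k) ^+ d.
Proof.
move=> b0; rewrite sum_words_rcons.
have prod0 t : 0 <= \prod_(k <- t) b k by apply: prodr_ge0.
(* Truncating [b] at [q] encodes the bound on the other letters inside the product, so that
   [sum_words] applies. *)
pose b' q k := if (k <= q)%N then b k else 0.
have b'0 q k : 0 <= b' q k by rewrite /b'; case: ifP.
rewrite (@le_trans _ _ (\sum_(t <- words n d) \sum_(q <- iota 0 n)
    b q ^+ 2 * \prod_(k <- t) b' q k))//.
  apply: ler_sum => t _; rewrite big_mkcond; apply: ler_sum => q _.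
  rewrite rcons_path last_rcons big_rcons /=.
  have [/andP[pt lt]|_] := ifPn; last by rewrite mulr_ge0 ?exprn_ge0 ?prodr_ge0.
  rewrite -mulrA -expr2 [leLHS]mulrC ler_wpM2l ?exprn_ge0// le_eqVlt.
  apply/orP; left; apply/eqP; apply: eq_big_seq => k kt.
  by rewrite /b' ifT// (leq_trans (path_leq_last pt kt)).
rewrite exchange_big /=; apply: ler_sum_seq => q.
rewrite mem_iota add0n => /andP[_ qn] _.
rewrite -big_distrr /= ler_wpM2l ?exprn_ge0// sum_words.
rewrite lerXn2r ?nnegrE ?sumr_ge0//.
rewrite -(subnKC qn) iotaD big_cat /= [X in _ + X]big1_seq ?addr0.
  by apply: ler_sum_seq => k; rewrite -/(iota 0 q.+1) mem_iota /b' add0n ltnS => /andP[_ ->].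
by move=> k /=; rewrite mem_iota add0n /b' => /andP[kq _]; rewrite leqNgt kq.
Qed.

Lemma ln2D_gt0 k : 0 < ln k.+2%:R :> R.
Proof. by rewrite ln_gt0// ltr1n. Qed.

(* Telescoping: [1/ln x - 1/ln (x+1) >= 1/(4 x ln^2 x)] for [x >= 2]. *)
Lemma sum_inv_mul_sqr_ln n :
  \sum_(k <- iota 0 n) (k.+2%:R * ln k.+2%:R ^+ 2)^-1 <= 4 / ln 2 :> R.
Proof.
suff H : \sum_(k <- iota 0 n) (k.+2%:R * ln k.+2%:R ^+ 2)^-1 <=
    4 / ln 2 - 4 / ln n.+2%:R :> R.
  by apply: le_trans H _; rewrite gerBl divr_ge0// ltW// ln2D_gt0.
elim: n => [|n IH]; first by rewrite big_nil subrr.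
rewrite -addn1 iotaD big_cat big_seq1 add0n addn1 /=.
apply: le_trans (lerD IH (lexx _)) _; rewrite -subr_ge0.
set x : R := n.+2%:R; have x2 : 2 <= x by rewrite ler_nat.
have -> : n.+3%:R = x + 1 by rewrite -natr1.
have lx : 0 < ln x by rewrite ln2D_gt0.
have x0 : 0 < x by lra.
have lx1 : 0 < ln (x + 1) by rewrite ln_gt0//; lra.
have l1 : ln (x + 1) <= 2 * ln x.
  rewrite mulr_natl mulr2n -lnM ?posrE// ler_ln ?posrE ?mulr_gt0//; nra.
have l2 : (x + 1)^-1 <= ln (x + 1) - ln x.
  rewrite -ln_div ?posrE//; last lra.
  have h : -1 < - (x + 1)^-1 by rewrite ltrN2 invf_lt1; lra.
  have := le_ln1Dx h.
  have -> : 1 + - (x + 1)^-1 = (x / (x + 1)) by field; lra.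
  rewrite !ln_div ?posrE; lra.
(* Over a common denominator, the numerator is nonnegative because ln (x+1) <= 2 ln x and 4x (ln
   (x+1) - ln x) >= 4x / (x+1) >= 2. *)
have -> : 4 / ln 2 - 4 / ln (x + 1) - (4 / ln 2 - 4 / ln x + (x * ln x ^+ 2)^-1) =
    (4 * x * ln x * (ln (x + 1) - ln x) - ln (x + 1)) / (x * ln x ^+ 2 * ln (x + 1)).
  by field; rewrite !gt_eqF// ?ln2D_gt0.
apply: divr_ge0; last by rewrite !mulr_ge0 ?exprn_ge0 ?ltW.
have l3 : 2 <= (4 * x) * (ln (x + 1) - ln x).
  have : 2 <= (4 * x) * (x + 1)^-1 by rewrite ler_pdivlMr; lra.
  by move=> /le_trans; apply; rewrite ler_wpM2l// mulr_ge0// ltW.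
have -> : 4 * x * ln x * (ln (x + 1) - ln x) = 4 * x * (ln (x + 1) - ln x) * ln x.
  by ring.
by rewrite subr_ge0 (le_trans l1)// ler_wpM2r// ltW.
Qed.

(* With [x = (k+2)^(1/m)] and [y = (k+1)^(1/m)] the increment is controlled by
   [1 = x^m - y^m <= (x - y) m x^(m-1)]. *)
Lemma sum_inv_root m n : (0 < m)%N ->
  \sum_(k <- iota 0 n) ((k.+2%:R `^ m%:R^-1) ^+ m.-1)^-1 <=
  m%:R * n.+1%:R `^ m%:R^-1 :> R.
Proof.
move=> m0; have mR : m%:R != 0 :> R by rewrite pnatr_eq0 -lt0n.
have XE k : (k.+1%:R `^ m%:R^-1) ^+ m = k.+1%:R :> R.
  by rewrite -powR_mulrn ?powR_ge0// -powRrM mulVf// powRr1.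
elim: n => [|n IH]; first by rewrite big_nil mulr_ge0// powR_ge0.
rewrite -addn1 iotaD big_cat big_seq1 add0n addn1 /=.
apply: le_trans (lerD IH (lexx _)) _.
set x := n.+2%:R `^ _; set y := n.+1%:R `^ _.
have x0 : 0 < x by rewrite powR_gt0.
have y0 : 0 < y by rewrite powR_gt0.
have yx : y <= x by rewrite ge0_ler_powR ?nnegrE ?invr_ge0 ?ler_nat.
rewrite -lerBrDl -mulrBr -[leLHS]mul1r ler_pdivrMr ?exprn_gt0//.
have xy1 : x ^+ m - y ^+ m = 1 by rewrite !XE -[n.+2]addn1 natrD; ring.
rewrite -[leLHS]xy1 subrXX [m%:R * _]mulrC -mulrA ler_wpM2l ?subr_ge0//.
apply: (@le_trans _ _ (\sum_(i < m) x ^+ m.-1)); last first.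
  by rewrite sumr_const card_ord mulr_natl.
apply: ler_sum => i _; have im : (i <= m.-1)%N by rewrite -ltnS prednK.
rewrite -[X in _ <= _ ^+ X](subnK im) exprD.
by rewrite ler_wpM2l ?exprn_ge0 ?lerXn2r ?nnegrE// ltW.
Qed.

(** Let m >= 2 and x_q = (q+2)^(1/m). The partial sums of [b] are O(x_q), so the q-th term in
    [sum_sorted_le] is of order x_q^(-2(m-1)) x_q^(m-2) / ln^2 (q+2) = 1 / ((q+2) ln^2 (q+2)). *)
Lemma sum_sorted_bounded b m D : (0 < m)%N -> (forall k, 0 <= b k) ->
  (forall k, b k <= D / (k.+2%:R `^ m%:R^-1) ^+ m.-1 / ln k.+2%:R) ->
  exists K, forall n, \sum_(t <- words n m.-1 | path leq 0 t)
    (\prod_(k <- t) b k) * b (last 0 t) <= K.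
Proof.
case: m => [//|[|d]] _ b0 bD.
  (* For m = 1 the only word is empty, and the default value 0 of [last] leaves the single term
     [b 0]. *)
  by exists (b 0) => n; rewrite /= big_mkcond big_seq1 /= big_nil mul1r.
set m := d.+2 in bD *; pose x k : R := k.+2%:R `^ m%:R^-1.
have x0 k : 0 < x k by rewrite powR_gt0.
have D0 : 0 <= D.
  have := le_trans (b0 0) (bD 0).
  by rewrite -mulrA pmulr_lge0// divr_gt0 ?ln2D_gt0 ?exprn_gt0.
have xm k : x k ^+ m = k.+2%:R.
  by rewrite /x -powR_mulrn ?powR_ge0// -powRrM mulVf ?powRr1// pnatr_eq0.
pose E := D / ln 2 * m%:R.
have l2 : 0 <= ln 2 :> R by rewrite ltW// ln2D_gt0.
have E0 : 0 <= E by rewrite mulr_ge0 ?divr_ge0.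
exists (D ^+ 2 * E ^+ d * (4 / ln 2)) => n.
apply: le_trans (sum_sorted_le n d b0) _.
apply: (@le_trans _ _ (\sum_(q <- iota 0 n) D ^+ 2 * E ^+ d *
    (q.+2%:R * ln q.+2%:R ^+ 2)^-1)); last first.
  by rewrite -big_distrr ler_wpM2l ?mulr_ge0 ?exprn_ge0// sum_inv_mul_sqr_ln.
apply: ler_sum => q _.
(* Each logarithm is replaced by its least value [ln 2], which leaves the sum estimated in
   [sum_inv_root]. *)
have B : \sum_(k <- iota 0 q.+1) b k <= E * x q.
  apply: (@le_trans _ _ (\sum_(k <- iota 0 q.+1) D / ln 2 * (x k ^+ m.-1)^-1)).
    apply: ler_sum => k _; apply: le_trans (bD k) _; rewrite mulrAC.
    have xk : 0 <= (x k ^+ m.-1)^-1 by rewrite invr_ge0 exprn_ge0// ltW.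
    rewrite ler_wpM2r// ler_wpM2l//.
    by rewrite ler_pV2 ?inE ?unitfE ?gt_eqF ?ln2D_gt0// ler_ln ?posrE// ler_nat.
  rewrite -big_distrr -mulrA ler_wpM2l ?divr_ge0//.
  exact: sum_inv_root.
have -> : D ^+ 2 * E ^+ d * (q.+2%:R * ln q.+2%:R ^+ 2)^-1 =
    (D / x q ^+ m.-1 / ln q.+2%:R) ^+ 2 * (E * x q) ^+ d.
  rewrite -[X in (X * _)^-1]xm /m /= !exprMn !exprS; field.
  by rewrite !gt_eqF ?exprn_gt0 ?ln2D_gt0.
rewrite ler_pM ?exprn_ge0 ?sumr_ge0// lerXn2r ?nnegrE ?sumr_ge0//.
  by rewrite (le_trans (b0 q)).
by rewrite mulr_ge0// ltW.
Qed.

End Summability.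

(** * Polarization *)

Section Polarization.
Variable C : comNzRingType.
Variable m : nat.
Implicit Types (f : {ffun 'I_m -> 'I_m}) (e : {ffun 'I_m -> bool}).

(** The sum over signs factors over the coordinates l: if l has n_l preimages under [f], its factor
    is 1 + (-1)^(n_l + 1). This is 2 for every l when [f] is injective, since then n_l = 1;
    otherwise some l is missed and its factor vanishes. *)
Lemma sum_prod_sign f :
  \sum_(e : {ffun 'I_m -> bool}) (\prod_l (-1) ^+ e l) * (\prod_a (-1) ^+ e (f a)) =
  if injectiveb f then 2 ^+ m else 0 :> C.
Proof.
pose n l := #|[pred a | f a == l]|.
have -> : \sum_(e : {ffun 'I_m -> bool}) (\prod_l (-1) ^+ e l) * (\prod_a (-1) ^+ e (f a)) =
    \prod_l \sum_(b : bool) (-1) ^+ b * ((-1) ^+ b) ^+ n l :> C.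
  rewrite bigA_distr_bigA; apply: eq_bigr => e _; rewrite big_split /=.
  congr (_ * _); rewrite (partition_big f xpredT)//=; apply: eq_bigr => l _.
  by rewrite -prodr_const; apply: eq_big => // a /eqP ->.
under eq_bigr do rewrite big_bool /= expr0 expr1n mul1r expr1 -exprS.
case: ifPn => [/injectiveP fI|fN].
  rewrite -[m in RHS]card_ord -prodr_const; apply: eq_bigr => l _.
  suff -> : n l = 1%N by rewrite -signr_odd expr0.
  rewrite /n -(card1 (invF fI l)); apply: eq_card => a.
  by rewrite !inE -{1}[l](f_invF fI) (inj_eq fI).
have [l fl] : exists l, l \notin codom f.
  apply/existsP; rewrite -negb_forall; apply: contra fN => /forallP sf.
  have /image_injP fI : #|fintype.image f 'I_m| == #|'I_m|.
    by apply/eqP/eq_card => l; rewrite [RHS]inE; exact: sf.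
  by apply/injectiveP => a b; exact: fI.
rewrite (bigD1 l)//= (_ : n l = 0%N) ?expr1 ?addNr ?mul0r//.
by apply: eq_card0 => a; rewrite !inE; apply: contraNF fl => /eqP <-; exact: codom_f.
Qed.

(** Expanding the product of sums gives one term for each self-map [f] of the index set, and the
    signs keep only the permutations. The right-hand side is 2^m times the permanent of [y]. *)
Lemma polarization (y : 'I_m -> 'I_m -> C) :
  \sum_(e : {ffun 'I_m -> bool}) (\prod_l (-1) ^+ e l) * \prod_a \sum_l (-1) ^+ e l * y a l =
  2 ^+ m * \sum_(f : {ffun 'I_m -> 'I_m} | injectiveb f) \prod_a y a (f a).
Proof.
under eq_bigr do rewrite bigA_distr_bigA big_distrr /=.
rewrite exchange_big /= big_distrr /= [RHS]big_mkcond /=; apply: eq_bigr => f _.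
under eq_bigr do rewrite big_split mulrA /=.
by rewrite -big_distrl sum_prod_sign /=; case: ifP; rewrite ?mul0r.
Qed.
End Polarization.

(** * Monomial expansions as finite sums over words *)

Section Expansion.
Variable R : realType.
Local Notation C := R[i].
Local Notation cseq := (nat -> C).

Lemma path0_leq (t : seq nat) : path leq 0 t = sorted leq t.
Proof. by case: t. Qed.

(* Junk value [c (0, ..., 0)] on words whose length is not [m]. *)
Definition wcoef m (c : m.-tuple nat -> C) (t : seq nat) : C :=
  c (insubd (nseq_tuple m 0%N) t).

Lemma wcoef_tuple m (c : m.-tuple nat -> C) (j : m.-tuple nat) :
  wcoef c j = c j.
Proof. by rewrite /wcoef valKd. Qed.

(** A monomial with a letter at least [n] vanishes at [z], so the nondecreasing words on the first
    [n] indices suffice. Sortedness is written [path leq 0] because this form splits well along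
    [rcons]. *)
Lemma expansion_words m P (c : m.-tuple nat -> C) (z : cseq) n :
  monomial_expansion P c -> (forall k, (n <= k)%N -> z k = 0) ->
  P z = \sum_(t <- words n m | path leq 0 t) wcoef c t * \prod_(k <- t) z k.
Proof.
move=> Pc zn; rewrite Pc; last by exists n.
pose s := [seq insubd (nseq_tuple m 0%N) t | t <- words n m & path leq 0 t].
have sE t : t \in words n m -> insubd (nseq_tuple m 0%N) t = t :> seq nat.
  by rewrite mem_words => /andP[st _]; rewrite insubdK.
have us : uniq s.
  rewrite map_inj_in_uniq ?filter_uniq ?uniq_words// => t u.
  rewrite !mem_filter => /andP[_ tn] /andP[_ un] /(congr1 val) /=.
  by rewrite !sE.
have Js j : j \in s -> Jset m j.
  move=> /mapP[t]; rewrite mem_filter => /andP[pt tn] ->.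
  by rewrite /Jset /= sE// -path0_leq.
rewrite (@fsbigE _ _ _ _ _ s)//; last first.
  move=> j Jj js; have : ~~ all (fun k => k < n)%N j.
    apply: contra js => jn; apply/mapP; exists (val j); last by rewrite valKd.
    by rewrite mem_filter mem_words size_tuple eqxx path0_leq jn !andbT.
  case/allPn => k kj; rewrite -leqNgt => nk.
  by rewrite /mono (big_rem k)//= zn// mul0r mulr0.
rewrite big_seq_cond (eq_bigl (mem s)); last first.
  by move=> j /=; rewrite andb_idr// => js; rewrite inE; exact: Js.
rewrite -big_seq big_map big_filter big_seq_cond [RHS]big_seq_cond.
by apply: eq_bigr => t /andP[tn _]; rewrite /mono sE.
Qed.

End Expansion.

(** * Partial sums and the norm of ell_r *)

Section LrNorm.
Variable R : realType.
Local Notation C := R[i].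
Local Notation Nc := (@Normc.normc R).

Lemma normr_normc (z : C) : `|z| = (Nc z)%:C%C.
Proof. by rewrite normc_def; case: z. Qed.

Lemma normc_ge0 (z : C) : 0 <= Nc z.
Proof. by case: z => x y; exact: sqrtr_ge0. Qed.

Lemma normc_real (x : R) : Nc x%:C%C = `|x|.
Proof. by rewrite /Normc.normc /= expr0n addr0 sqrtr_sqr. Qed.

Lemma normc_sum (I : Type) (s : seq I) (F : I -> C) :
  Nc (\sum_(i <- s) F i) <= \sum_(i <- s) Nc (F i).
Proof.
rewrite -lecR -normr_normc rmorph_sum /=; apply: le_trans (ler_norm_sum _ _ _) _.
by apply: ler_sum => i _; rewrite normr_normc.
Qed.

Lemma normc_prod (I : Type) (s : seq I) (F : I -> C) :
  Nc (\prod_(i <- s) F i) = \prod_(i <- s) Nc (F i).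
Proof. exact: (big_morph _ (@Normc.normcM R) (@Normc.normc1 R)). Qed.

Variable r : R.
Hypothesis r0 : 0 < r.
Implicit Type u : nat -> C.

Lemma lr_normE u :
  lr_norm r u = ((\sum_(0 <= k <oo) (Nc (u k) `^ r)%:E) `^ r^-1)%E.
Proof.
rewrite /lr_norm Lnorm_counting//; congr (_ `^ _)%E; apply: eq_eseriesr => k _.
by rewrite /= ger0_norm ?normc_ge0.
Qed.

Lemma nneseries_le_bound u (W : R) :
  (forall n, \sum_(k <- iota 0 n) Nc (u k) `^ r <= W) ->
  (\sum_(0 <= k <oo) (Nc (u k) `^ r)%:E <= W%:E)%E.
Proof.
move=> uW; apply: lime_le.
  by apply: is_cvg_nneseries => k _ _; rewrite lee_fin powR_ge0.
by apply: nearW => n; rewrite sumEFin lee_fin /index_iota subn0.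
Qed.

(** This replaces the norm by finite partial sums. Finiteness of the series follows from that of its
    power because the exponent [r^-1] is nonzero. *)
Lemma ellP u : ell r u <->
  exists W : R, forall n, \sum_(k <- iota 0 n) Nc (u k) `^ r <= W.
Proof.
have pos k : (0 <= (Nc (u k) `^ r)%:E)%E by rewrite lee_fin powR_ge0.
rewrite /ell /= lr_normE; split; last first.
  move=> [W uW]; apply: poweR_lty; apply: le_lt_trans (nneseries_le_bound uW) _.
  exact: ltry.
set S := (\sum_(0 <= k <oo) _)%E => Sr.
have S0 : (0 <= S)%E by apply: nneseries_ge0.
have Sfin : S \is a fin_num.
  by rewrite ge0_fin_numE// (lty_poweRy _ Sr)// invr_neq0// gt_eqF.
exists (fine S) => n; rewrite -lee_fin fineK// -sumEFin.
have := @nneseries_lim_ge R _ xpredT 0%N n (fun k _ _ => pos k).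
by rewrite /index_iota subn0.
Qed.

Lemma lr_norm_le1 u n : (forall k, (n <= k)%N -> u k = 0) ->
  \sum_(k <- iota 0 n) Nc (u k) `^ r <= 1 -> (lr_norm r u <= 1)%E.
Proof.
move=> un u1; rewrite lr_normE -(poweR1r r^-1).
apply: gt0_ler_poweR; first by rewrite invr_ge0 ltW.
- rewrite in_itv /= leey andbT; apply: nneseries_ge0 => k _ _.
  by rewrite lee_fin powR_ge0.
- by rewrite in_itv /= leey andbT.
apply: nneseries_le_bound => N; apply: le_trans u1.
case: (leqP N n) => [Nn|/ltnW nN].
  rewrite -(subnKC Nn) iotaD big_cat /= lerDl sumr_ge0// => k _.
  exact: powR_ge0.
rewrite -(subnKC nN) iotaD big_cat /= [X in _ + X]big1_seq ?addr0//.
move=> k /=; rewrite mem_iota add0n => /andP[/un -> _].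
by rewrite Normc.normc0 powR0// gt_eqF.
Qed.

End LrNorm.

(** Every summand is bounded by the largest one. The crude constant is later absorbed by scaling the
    polarization arguments. *)
Lemma powR_sum_le (R : realType) (r : R) m (u : 'I_m.+1 -> R) : 0 <= r ->
  (forall l, 0 <= u l) ->
  (\sum_l u l) `^ r <= m.+1%:R `^ r * \sum_l u l `^ r.
Proof.
move=> r0 u0; pose l0 := [arg max_(l > ord0) u l]%O.
have ul0 l : u l <= u l0 by rewrite /l0; case: arg_maxP => // i _; exact.
apply: (@le_trans _ _ ((m.+1%:R * u l0) `^ r)).
  rewrite ge0_ler_powR ?nnegrE ?sumr_ge0 ?mulr_ge0//.
  apply: le_trans (ler_sum _ (fun l _ => ul0 l)) _.
  by rewrite sumr_const card_ord mulr_natl.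
rewrite powRM// ler_wpM2l ?powR_ge0// (bigD1 l0)//= lerDl sumr_ge0// => l _.
exact: powR_ge0.
Qed.

(** * Uniform bound on the last coefficient index *)

Section CoefficientBound.
Variable R : realType.
Local Notation C := R[i].
Local Notation Nc := (@Normc.normc R).
Variable d : nat.
Local Notation m := d.+1.

(** Polarization is applied to each monomial [t] separately: the positions in [t] index the factors,
    and the arguments [x l] supply the signed summands. *)
Lemma polarized_expansion P (c : m.-tuple nat -> C) (x : 'I_m -> nat -> C) n :
  monomial_expansion P c -> (forall l k, (n <= k)%N -> x l k = 0) ->
  \sum_(e : {ffun 'I_m -> bool})
    (\prod_l (-1) ^+ e l) * P (fun k => \sum_l (-1) ^+ e l * x l k) =
  2 ^+ m * \sum_(t <- words n m | path leq 0 t) wcoef c t *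
    \sum_(f : {ffun 'I_m -> 'I_m} | injectiveb f) \prod_a x (f a) (nth 0%N t a).
Proof.
move=> Pc xn; under eq_bigr => e _.
  rewrite (@expansion_words _ _ _ _ _ n Pc); last first.
    by move=> k nk; rewrite big1// => l _; rewrite xn// mulr0.
  rewrite big_distrr /=; over.
rewrite exchange_big big_distrr /= big_seq_cond [RHS]big_seq_cond.
apply: eq_bigr => t /andP[]; rewrite -/(words n m) mem_words => /andP[/eqP st _] _.
rewrite mulrCA -(polarization (fun a l => x l (nth 0%N t a))) big_distrr /=.
apply: eq_bigr => e _; rewrite mulrCA; congr (_ * (_ * _)).
by rewrite (big_nth 0%N) st big_mkord.
Qed.

(* The polarization arguments: unit vectors e_(i_0), ..., e_(i_(d-1)), then y. *)
Definition unit_or (i : seq nat) (y : nat -> C) (l : 'I_m) (k : nat) : C :=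
  if (l < d)%N then (k == nth 0%N i l)%:R else y k.

(** If the product is nonzero, each unit vector forces a letter of [i] at the corresponding position
    of [t], and the one remaining position carries some k >= max i. Hence [t] is a rearrangement of
    [rcons i k]; both are sorted, so they coincide. *)
Lemma prod_unit_or (i t : seq nat) y (f : {ffun 'I_m -> 'I_m}) :
  size i = d -> path leq 0 i -> (forall k, y k != 0 -> (last 0 i <= k)%N) ->
  size t = m -> path leq 0 t -> injectiveb f ->
  \prod_a unit_or i y (f a) (nth 0%N t a) != 0 ->
  exists2 k, t = rcons i k &
    \prod_a unit_or i y (f a) (nth 0%N t a) = y k.
Proof.
move=> si pi yi st pt /injectiveP fI T0.
have Fa a : unit_or i y (f a) (nth 0%N t a) != 0.
  by move: T0; rewrite prodf_seq_neq0 => /allP/(_ a (mem_index_enum _)).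
have natb (b : bool) : b%:R != 0 :> C -> b by case: b => //; rewrite eqxx.
pose a0 := invF fI ord_max; have fa0 : f a0 = ord_max by rewrite f_invF.
pose k := nth 0%N t a0; exists k; last first.
  rewrite (bigD1 a0)//= {1}/unit_or fa0 /= ltnn big1 ?mulr1// => a aa0.
  have := Fa a; rewrite /unit_or ifT; first by move=> /natb ->.
  rewrite ltn_neqAle -ltnS ltn_ord andbT.
  by apply: contra aa0 => /eqP fad; apply/eqP/fI; rewrite fa0; exact: val_inj.
have tE (a : 'I_m) : nth 0%N t a = nth 0%N (rcons i k) (f a).
  have := Fa a; rewrite /unit_or nth_rcons si; case: ltnP => fad.
    by move=> /natb /eqP.
  have fadE : f a = ord_max.
    by apply: val_inj; apply/eqP; rewrite eqn_leq fad -ltnS ltn_ord.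
  by move=> _; rewrite fadE /= eqxx /k; congr (nth _ _ (nat_of_ord _)); apply/fI; rewrite fa0.
have yk : (last 0 i <= k)%N.
  by apply: yi; have := Fa a0; rewrite /unit_or fa0 /= ltnn.
apply: (sorted_eq leq_trans anti_leq).
- by rewrite -path0_leq.
- by rewrite -path0_leq rcons_path pi.
have mapE s : size s = m -> s = [seq nth 0%N s (val a) | a <- enum 'I_m].
  by move=> ss; rewrite map_comp val_enum_ord -{1}ss -/(mkseq _ _) mkseq_nth.
rewrite (mapE t st) (mapE (rcons i k)) ?size_rcons ?si//.
rewrite (eq_map (g := (fun a : 'I_m => nth 0%N (rcons i k) a) \o f))// map_comp.
apply: perm_map; apply: uniq_perm => [||l].
- by rewrite map_inj_uniq ?enum_uniq.
- exact: enum_uniq.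
by rewrite mem_enum -[l](f_invF fI) map_f ?mem_enum.
Qed.

Lemma prod_unit_or_id (i : seq nat) y k : size i = d ->
  \prod_(a < m) unit_or i y a (nth 0%N (rcons i k) a) = y k.
Proof.
move=> si; rewrite big_ord_recr /= {2}/unit_or ltnn nth_rcons si ltnn eqxx.
rewrite big1 ?mul1r// => a _; rewrite /unit_or /= ltn_ord.
by rewrite nth_rcons si ltn_ord eqxx.
Qed.

Variable r : R.
Hypothesis r1 : 1 <= r.

(** Each of the m arguments has norm at most 1; [powR_sum_le] and the summation over [l] cost a
    factor m^r m. With the scaling by m^(-2) the total is m^(-2r) m^r m = m^(1-r) <= 1. *)
Lemma lr_norm_signed_sum_le1 (i : seq nat) n (y : nat -> C)
    (e : {ffun 'I_m -> bool}) :
  i \in words n d -> (forall k, (n <= k)%N -> y k = 0) ->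
  \sum_(k <- iota 0 n) Nc (y k) `^ r <= 1 ->
  (lr_norm r (fun k => \sum_l (-1) ^+ e l *
     ((m%:R ^- 2)%:C%C * unit_or i y l k))%R <= 1)%E.
Proof.
have r0 : 0 < r by apply: lt_le_trans r1.
rewrite mem_words => /andP[/eqP si /allP iN] yn y1.
have un l k : (n <= k)%N -> unit_or i y l k = 0.
  rewrite /unit_or => nk; case: ifP => ld; last exact: yn.
  case: eqVneq => // kE; have := iN (nth 0%N i l).
  by rewrite mem_nth ?si// -kE ltnNge nk => /(_ isT).
have u1 l : \sum_(k <- iota 0 n) Nc (unit_or i y l k) `^ r <= 1.
  rewrite /unit_or; have [ld|//] := boolP (l < d)%N.
  have il : (nth 0 i l < n)%N by apply: iN; rewrite mem_nth ?si.
  rewrite (bigD1_seq (nth 0%N i l)) ?iota_uniq ?mem_iota//= eqxx Normc.normc1.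
  rewrite powR1 big1 ?addr0// => k /negPf ->.
  by rewrite Normc.normc0 powR0// gt_eqF.
apply: (lr_norm_le1 r0 (n := n)).
  by move=> k nk; rewrite big1// => l _; rewrite un// !mulr0.
have m0 : 0 < m%:R :> R by rewrite ltr0n.
have mE : (m%:R ^- 2) * m%:R * m%:R = 1 :> R by field; rewrite gt_eqF.
rewrite -[leRHS]mE.
apply: (@le_trans _ _ (\sum_(k <- iota 0 n) ((m%:R ^- 2) `^ r * m%:R `^ r) *
    \sum_l Nc (unit_or i y l k) `^ r)).
  apply: ler_sum => k _; rewrite -mulrA.
  have v0 l : 0 <= Nc (unit_or i y l k) by exact: normc_ge0.
  apply: (@le_trans _ _ ((m%:R ^- 2) `^ r * (\sum_l Nc (unit_or i y l k)) `^ r)).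
    rewrite -powRM ?sumr_ge0 ?invr_ge0 ?exprn_ge0//.
    rewrite ge0_ler_powR ?nnegrE ?normc_ge0 ?mulr_ge0 ?sumr_ge0 ?(ltW r0)//.
    apply: le_trans (normc_sum _ _) _; rewrite big_distrr /=.
    apply: ler_sum => l _; rewrite !Normc.normcM normc_real.
    rewrite ger0_norm ?invr_ge0 ?exprn_ge0//.
    by rewrite -(rmorph_sign (real_complex R)) normc_real normr_sign mul1r.
  by rewrite ler_wpM2l ?powR_ge0// powR_sum_le// ltW.
rewrite -big_distrr exchange_big /= ler_pM ?mulr_ge0 ?powR_ge0 ?sumr_ge0//.
- by move=> l _; apply: sumr_ge0 => k _; exact: powR_ge0.
- rewrite -powRM//; apply: ge1r_powR => //.
  have -> : (m%:R ^- 2) * m%:R = m%:R^-1 :> R by field; rewrite gt_eqF.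
  by rewrite invr_gt0 m0 invf_le1// ler1n.
- by apply: le_trans (ler_sum _ (fun l _ => u1 l)) _; rewrite sumr_const card_ord.
Qed.

(** The polarized form is evaluated at the unit vectors of [i] and at a [y] whose phases are matched
    to the coefficients. The factor (m^2)^m undoes the scaling by m^(-2) of the m arguments. *)
Lemma sum_normc_coef_le P (c : m.-tuple nat -> C) M (i : seq nat) n
    (b : nat -> R) :
  monomial_expansion P c ->
  (forall z, (lr_norm r z <= 1)%E -> Nc (P z) <= M) ->
  i \in words n d -> path leq 0 i -> (forall k, 0 <= b k) ->
  \sum_(k <- iota 0 n) b k `^ r <= 1 ->
  \sum_(k <- iota 0 n | (last 0 i <= k)%N) Nc (wcoef c (rcons i k)) * b k <=
  M * (m%:R ^+ 2) ^+ m.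
Proof.
move=> Pc PM iN pi b0 b1; set S := \sum_(k <- _ | _) _.
have si : size i = d by move: iN; rewrite mem_words => /andP[/eqP].
pose lam : R := m%:R ^- 2.
have lam0 : 0 < lam by rewrite invr_gt0 exprn_gt0// ltr0n.
(* The phases of [y] make every term of the polarized expansion nonnegative. *)
pose y k : C := if (last 0 i <= k < n)%N then
  `|wcoef c (rcons i k)| / wcoef c (rcons i k) * (b k)%:C%C else 0.
have yn k : (n <= k)%N -> y k = 0.
  by rewrite /y ltnNge => ->; rewrite andbF.
have yi k : y k != 0 -> (last 0 i <= k)%N.
  by rewrite /y; case: ifP => [/andP[]//|_]; rewrite eqxx.
have cy k : wcoef c (rcons i k) * y k =
    (if (last 0 i <= k < n)%N then Nc (wcoef c (rcons i k)) * b k else 0)%:C%C.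
  rewrite /y; case: ifP => _; last by rewrite mulr0.
  have [->|c0] := eqVneq (wcoef c (rcons i k)) 0.
    by rewrite mul0r Normc.normc0 mul0r.
  by rewrite mulrA mulrCA mulfV// mulr1 normr_normc -rmorphM.
have cy0 k : 0 <= wcoef c (rcons i k) * y k.
  by rewrite cy lecR; case: ifP => // _; rewrite mulr_ge0 ?normc_ge0.
have Ny k : Nc (y k) <= b k.
  rewrite /y; case: ifP => _; last by rewrite Normc.normc0.
  rewrite Normc.normcM normc_real [`|b k|]ger0_norm// ler_piMl//.
  rewrite normr_normc Normc.normcM Normc.normcV normc_real.
  have [->|c0] := eqVneq (Nc (wcoef c (rcons i k))) 0; first by rewrite normr0 mul0r.
  by rewrite ger0_norm ?normc_ge0// divff.
have y1 : \sum_(k <- iota 0 n) Nc (y k) `^ r <= 1.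
  apply: le_trans b1; apply: ler_sum => k _.
  by rewrite ge0_ler_powR ?nnegrE ?normc_ge0// (le_trans _ r1).
pose T t (f : {ffun 'I_m -> 'I_m}) :=
  wcoef c t * \prod_a unit_or i y (f a) (nth 0%N t a).
have T0 t (f : {ffun 'I_m -> 'I_m}) : size t = m -> path leq 0 t -> injectiveb f -> 0 <= T t f.
  move=> st pt fI; have [T0|T0] := eqVneq (\prod_a unit_or i y (f a) (nth 0%N t a)) 0.
    by rewrite /T T0 mulr0.
  by have [k tE fE] := prod_unit_or si pi yi st pt fI T0; rewrite /T fE tE.
pose id_f : {ffun 'I_m -> 'I_m} := [ffun a => a].
have id_fI : injectiveb id_f by apply/injectiveP => a a'; rewrite !ffunE.
have T_id k : T (rcons i k) id_f = wcoef c (rcons i k) * y k.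
  rewrite /T -(prod_unit_or_id y k si); congr (_ * _).
  by apply: eq_bigr => a _; rewrite ffunE.
(* All terms being nonnegative, the prefixes other than [i] are discarded, and then the permutations
   other than the identity. *)
have SC : S%:C%C <= \sum_(t <- words n m | path leq 0 t)
    \sum_(f : {ffun 'I_m -> 'I_m} | injectiveb f) T t f.
  rewrite sum_words_rcons (bigD1_seq i) ?uniq_words//=.
  have F0 u k : u \in words n d -> path leq 0 (rcons u k) ->
      0 <= \sum_(f : {ffun 'I_m -> 'I_m} | injectiveb f) T (rcons u k) f.
    rewrite mem_words => /andP[/eqP su _] pu.
    by apply: sumr_ge0 => f fI; apply: T0; rewrite ?size_rcons ?su.
  rewrite -[leLHS]addr0 lerD//; last first.
    rewrite big_seq_cond sumr_ge0// => u /andP[un _].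
    by apply: sumr_ge0 => k; exact: F0.
  rewrite rmorph_sum /= [leRHS](eq_bigl (fun k => last 0 i <= k)%N); last first.
    by move=> k; rewrite rcons_path pi.
  apply: ler_sum_seq => k; rewrite mem_iota add0n => /andP[_ kn] ik.
  rewrite (bigD1 id_f)//= T_id cy ik kn /= lerDl sumr_ge0// => f /andP[fI _].
  by apply: T0; rewrite ?size_rcons ?si// rcons_path pi.
have xn l k : (n <= k)%N -> lam%:C%C * unit_or i y l k = 0.
  move=> nk; rewrite /unit_or; case: ifP => ld; last by rewrite yn ?mulr0.
  case: eqVneq => [kE|_]; last by rewrite mulr0.
  move: iN; rewrite mem_words => /andP[_ /allP/(_ k)].
  by rewrite kE mem_nth ?si// -kE ltnNge nk => /(_ isT).
have := polarized_expansion Pc xn.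
have -> : \sum_(t <- words n m | path leq 0 t) wcoef c t *
    \sum_(f : {ffun 'I_m -> 'I_m} | injectiveb f)
      \prod_a (lam%:C%C * unit_or i y (f a) (nth 0%N t a)) =
    lam%:C%C ^+ m * \sum_(t <- words n m | path leq 0 t)
      \sum_(f : {ffun 'I_m -> 'I_m} | injectiveb f) T t f.
  rewrite big_distrr; apply: eq_bigr => t _ /=; rewrite !big_distrr.
  apply: eq_bigr => f _ /=; rewrite /T mulrCA; congr (_ * _).
  by rewrite big_split /= prodr_const card_ord.
set X := \sum_e _ => XE.
(* There are 2^m sign vectors, each evaluating [P] in the unit ball; this 2^m cancels the one
   produced by polarization. *)
have XM : `|X| <= (2 ^+ m * M)%:C%C.
  apply: le_trans (ler_norm_sum _ _ _) _.
  apply: (@le_trans _ _ (\sum_(e : {ffun 'I_m -> bool}) M%:C%C)); last first.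
    rewrite sumr_const card_ffun card_bool card_ord -[leLHS]mulr_natl natrX.
    by rewrite rmorphM rmorphXn rmorph_nat.
  apply: ler_sum => e _; rewrite normrM normr_prod big1 ?mul1r; last first.
    by move=> l _; rewrite normr_sign.
  by rewrite normr_normc lecR; apply: PM; exact: lr_norm_signed_sum_le1 iN yn y1.
have SX : (2 ^+ m * lam ^+ m * S)%:C%C <= X.
  rewrite XE -mulrA.
  by rewrite !rmorphM /= !rmorphXn /= rmorph_nat !ler_wpM2l ?exprn_ge0 ?ler0n// lecR ltW.
have S0 : 0 <= (2 ^+ m * lam ^+ m * S)%:C%C.
  rewrite lecR !mulr_ge0 ?exprn_ge0 ?(ltW lam0)// sumr_ge0// => k _.
  by rewrite mulr_ge0 ?normc_ge0.
move: XM; rewrite ger0_norm ?(le_trans S0)// => /(le_trans SX).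
rewrite lecR -mulrA ler_pM2l ?exprn_gt0//.
by rewrite /lam exprVn mulrC ler_pdivrMr ?exprn_gt0// ltr0n.
Qed.

End CoefficientBound.

(** * Sequences of weights *)

Lemma ler_sum_sub_uniq (R : numDomainType) (I : eqType) (s s' : seq I)
    (F : I -> R) : uniq s -> uniq s' -> {subset s <= s'} ->
  (forall i, 0 <= F i) -> \sum_(i <- s) F i <= \sum_(i <- s') F i.
Proof.
move=> us us' ss' F0; rewrite [leRHS](bigID (mem s)) /= -[leLHS]addr0.
rewrite lerD ?sumr_ge0// -[leRHS]big_filter le_eqVlt; apply/orP; left; apply/eqP.
apply/perm_big/uniq_perm; rewrite ?filter_uniq// => i.
by rewrite mem_filter; case: (boolP (i \in s)) => //= /ss' ->.
Qed.

Lemma powR_prod (R : realType) (x : R) (a : nat -> R) (s : seq nat) :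
  (forall k, 0 <= a k) ->
  (\prod_(k <- s) a k) `^ x = \prod_(k <- s) a k `^ x.
Proof.
move=> a0; elim: s => [|k s IH]; first by rewrite !big_nil powR1.
by rewrite !big_cons powRM ?IH// prodr_ge0.
Qed.

Section Weights.
Variable R : realType.
Local Notation C := R[i].
Local Notation Nc := (@Normc.normc R).

(** The entries of finitely many multi-indices all lie below some [n], so every finite partial sum
    is dominated by the sum over sorted words on [n] letters. *)
Lemma esum_Jset_lty m (c : m.-tuple nat -> C) (z : nat -> C) (K : R) :
  (forall n, \sum_(t <- words n m | path leq 0 t)
    Nc (wcoef c t * \prod_(k <- t) z k) <= K) ->
  (\esum_(j in Jset m) (Nc (c j * mono z j))%:E < +oo)%E.
Proof.
move=> cK; apply: le_lt_trans (ltry K); apply: ge_ereal_sup => _ [X [Xfin XJ] <-].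
have [s XE] := (finite_seqP X).1 Xfin.
have Xs j : X j <-> j \in undup s by rewrite XE mem_undup.
rewrite (@fsbigE _ _ _ _ _ (undup s)) ?undup_uniq//; last 2 first.
- by move=> j /= /Xs.
- by move=> j /Xs ->.
rewrite big_seq_cond (eq_bigl (fun j => j \in undup s)); last first.
  by move=> j; rewrite andb_idr// => /Xs; rewrite inE.
rewrite -big_seq sumEFin lee_fin.
pose n := (\max_(j <- undup s) \max_(k <- j) k).+1.
apply: le_trans (cK n); rewrite -[leRHS]big_filter.
rewrite (eq_bigr (fun j : m.-tuple nat =>
    Nc (wcoef c (val j) * \prod_(k <- val j) z k))); last first.
  by move=> j _; rewrite wcoef_tuple.
rewrite -(big_map val xpredT (fun t => Nc (wcoef c t * \prod_(k <- t) z k))).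
apply: ler_sum_sub_uniq => [||t|t]; last exact: normc_ge0.
- by rewrite (map_inj_uniq val_inj) undup_uniq.
- by rewrite filter_uniq// uniq_words.
case/mapP=> j js ->; rewrite mem_filter mem_words size_tuple eqxx path0_leq /=.
have /XJ Jj := (Xs j).2 js; rewrite [sorted _ _]Jj /=; apply/allP => k kj.
rewrite ltnS; apply: (@leq_trans (\max_(l <- j) l)).
  exact: (@leq_bigmax_seq _ _ xpredT id).
exact: (@leq_bigmax_seq _ _ xpredT (fun i : m.-tuple nat => \max_(l <- i) l)%N).
Qed.

Variables (r : R) (m : nat) (a : nat -> R) (D : R).
Hypotheses (r_gt1 : 1 < r) (m_gt0 : (0 < m)%N).
Hypotheses (a_ge0 : forall k, 0 <= a k).
Hypothesis a_anti : forall k l, (k <= l)%N -> a l <= a k.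
Hypothesis a_le : forall k,
  a k `^ (1 - r^-1)^-1 <= D / (k.+2%:R `^ m%:R^-1) ^+ m.-1 / ln k.+2%:R.

Lemma scaled_ell_sub_mon : scaled a (ell r) `<=` mon r m.
Proof.
have r0 : 0 < r by apply: lt_trans r_gt1.
move=> _ [w /(ellP r0)[W wW] <-]; set z := fun k : nat => _.
have zE k : Nc (z k) = a k * Nc (w k).
  by rewrite /z Normc.normcM normc_real ger0_norm.
have W0 : 0 <= W by have := wW 0%N; rewrite big_nil.
split.
  apply/(ellP r0); exists (a 0 `^ r * W) => n.
  apply: le_trans (ler_wpM2l (powR_ge0 _ _) (wW n)).
  rewrite big_distrr /=; apply: ler_sum => k _.
  rewrite zE powRM ?normc_ge0// ler_wpM2r ?powR_ge0//.
  by rewrite ge0_ler_powR ?nnegrE ?(ltW r0)// a_anti.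
move=> P hP; have Pc := hpoly_mcoefP r0 hP; case: hP => _ [M PM].
move: (mcoef P) Pc => c Pc.
(* The exponent conjugate to [r]. *)
pose q := (1 - r^-1)^-1.
have ri : 0 < 1 - r^-1 < 1 by rewrite subr_gt0 invf_lt1// r_gt1 gtrBl invr_gt0.
have q1 : 1 <= q by rewrite /q invf_ge1; case/andP: ri => // ? /ltW.
have [K0 bK] := sum_sorted_bounded m_gt0 (fun k => powR_ge0 (a k) q) a_le.
case: m m_gt0 c Pc bK => [//|d] _ c Pc bK.
have M0 : 0 <= M.
  apply: le_trans (normc_ge0 _) (PM (fun=> 0) _).
  by apply: (lr_norm_le1 r0 (n := 0%N)) => //; rewrite big_nil.
(* Dividing [w] by [V] normalizes it without an r-th root: W <= V <= V^r since V >= 1 and r > 1. *)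
pose V := 1 + W; have V1 : 1 <= V by rewrite lerDl.
have V0 : 0 < V by apply: lt_le_trans V1.
pose K1 := M * (d.+1%:R ^+ 2) ^+ d.+1.
have K10 : 0 <= K1 by rewrite mulr_ge0 ?exprn_ge0.
(* Since [a] is nonincreasing, a_k <= a_(max i) on the range of summation; what remains is the
   coefficient bound tested on [w / V]. *)
have inner n i : i \in words n d -> path leq 0 i ->
    \sum_(k <- iota 0 n | (last 0 i <= k)%N)
      Nc (wcoef c (rcons i k)) * Nc (z k) <= K1 * V * a (last 0 i).
  move=> iN pi.
  have b0 k : 0 <= Nc (w k) / V by rewrite divr_ge0 ?normc_ge0 ?(ltW V0).
  have b1 : \sum_(k <- iota 0 n) (Nc (w k) / V) `^ r <= 1.
    rewrite (eq_bigr (fun k => V^-1 `^ r * Nc (w k) `^ r)); last first.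
      by move=> k _; rewrite powRM ?normc_ge0 ?invr_ge0 ?(ltW V0)// mulrC.
    have VV : V^-1 `^ r * V `^ r = 1.
      by rewrite -powRM ?invr_ge0 ?(ltW V0)// mulVf ?gt_eqF// powR1.
    rewrite -big_distrr /= -[leRHS]VV ler_wpM2l ?powR_ge0//.
    apply: le_trans (wW n) _; apply: (@le_trans _ _ V); first by rewrite lerDr.
    by rewrite le1r_powR// ltW.
  have := sum_normc_coef_le (ltW r_gt1) Pc PM iN pi b0 b1; rewrite -/K1 => H.
  rewrite -mulrA; apply: le_trans (ler_wpM2r _ H); last first.
    by rewrite mulr_ge0 ?(ltW V0).
  rewrite big_distrl /=; apply: ler_sum => k ik.
  rewrite -mulrA ler_wpM2l ?normc_ge0// mulrA divfK ?gt_eqF// zE mulrC.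
  by rewrite ler_wpM2l ?normc_ge0// a_anti.
apply: (@esum_Jset_lty _ _ _ (K1 * V * (K0 + W ^+ d))) => n.
rewrite sum_words_rcons.
(* The last letter is summed by [inner], and z = a w is split into its factors on the prefix. *)
apply: (@le_trans _ _ (K1 * V * \sum_(i <- words n d | path leq 0 i)
    (\prod_(k <- i) a k * a (last 0 i)) * \prod_(k <- i) Nc (w k))).
  rewrite big_distrr /= big_seq [leRHS]big_seq_cond big_mkcondr /=.
  apply: ler_sum => i iN; case: ifPn => pi; last first.
    by rewrite big1// => k; rewrite rcons_path (negPf pi).
  rewrite (eq_bigl (fun k => last 0 i <= k)%N); last first.
    by move=> k; rewrite rcons_path pi.
  rewrite (eq_bigr (fun k => (\prod_(l <- i) Nc (z l)) *
      (Nc (wcoef c (rcons i k)) * Nc (z k)))); last first.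
    move=> k _; rewrite big_rcons /= Normc.normcM Normc.normcM normc_prod.
    by rewrite mulrCA mulrA.
  rewrite -big_distrr /=.
  apply: le_trans (ler_wpM2l _ (inner n i iN pi)) _.
    by apply: prodr_ge0 => k _; exact: normc_ge0.
  rewrite (eq_bigr (fun l => a l * Nc (w l))) ?big_split//= le_eqVlt.
  by apply/orP; left; apply/eqP; ring.
rewrite ler_wpM2l ?mulr_ge0 ?(ltW V0)//.
(* Young's inequality separates the weights from [w]; its factors 1/q and 1/r are at most 1 and are
   dropped. *)
apply: (@le_trans _ _ (\sum_(i <- words n d | path leq 0 i)
    ((\prod_(k <- i) a k `^ q) * a (last 0 i) `^ q +
     \prod_(k <- i) Nc (w k) `^ r))).
  apply: ler_sum => i pi.
  have A0 : 0 <= \prod_(k <- i) a k * a (last 0 i) by rewrite mulr_ge0 ?prodr_ge0.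
  have w0 k : 0 <= Nc (w k) by exact: normc_ge0.
  have B0 : 0 <= \prod_(k <- i) Nc (w k) by apply: prodr_ge0.
  have qr : q^-1 + r^-1 = 1 by rewrite /q invrK subrK.
  apply: le_trans (conjugate_powR A0 B0 _ r0 qr) _.
    by apply: lt_le_trans q1.
  rewrite powRM ?prodr_ge0// !powR_prod//.
  rewrite lerD// ler_piMr ?invf_le1 ?mulr_ge0 ?prodr_ge0 ?powR_ge0// ?(ltW r_gt1)//.
  - by move=> k _; exact: powR_ge0.
  - by apply: lt_le_trans q1.
  - by move=> k _; exact: powR_ge0.
rewrite big_split /= lerD ?bK//.
(* Without the ordering constraint the sum is the d-th power of a partial sum of |w_k|^r. *)
apply: (@le_trans _ _ (\sum_(i <- words n d) \prod_(k <- i) Nc (w k) `^ r)).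
  rewrite big_mkcond /=; apply: ler_sum => i _; case: ifP => // _.
  by apply: prodr_ge0 => k _; exact: powR_ge0.
rewrite sum_words lerXn2r ?nnegrE ?wW//.
by apply: sumr_ge0 => k _; exact: powR_ge0.
Qed.

End Weights.

Lemma increasing_ge_addn (p : nat -> nat) c :
  {homo p : k l / (k < l)%N} -> (c <= p 0)%N -> forall k, (k + c <= p k)%N.
Proof.
move=> p_incr p0; elim=> [//|k IH].
by rewrite addSn (leq_ltn_trans IH)// p_incr.
Qed.

(** * Powers of the primes as weights *)

Section PowerWeights.
Variables (R : realType) (r : R) (m : nat) (p : nat -> nat).
Hypotheses (r_gt1 : 1 < r) (m_gt0 : (0 < m)%N).
Hypotheses (p_incr : {homo p : k l / (k < l)%N}) (p0_ge2 : (2 <= p 0)%N).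
Local Notation sigma := ((m%:R - 1) / m%:R * (1 - 1 / r) : R).
Local Notation q := (1 - r^-1)^-1.

Lemma conjugate_exponent_gt0 : 0 < q.
Proof. by rewrite invr_gt0 subr_gt0 invf_lt1// (lt_trans _ r_gt1). Qed.

Lemma ler_p k l : (k <= l)%N -> (p k)%:R <= (p l)%:R :> R.
Proof.
by rewrite leq_eqVlt => /predU1P[->//|kl]; rewrite ler_nat ltnW// p_incr.
Qed.

Lemma le_add2_p k : k.+2%:R <= (p k)%:R :> R.
Proof. by rewrite ler_nat -addn2 increasing_ge_addn. Qed.

Lemma p_gt0 k : 0 < (p k)%:R :> R.
Proof. by apply: lt_le_trans (le_add2_p k). Qed.

Lemma ln_le_ln_p k : ln k.+2%:R <= ln (p k)%:R :> R.
Proof. by rewrite ler_ln ?posrE ?p_gt0// le_add2_p. Qed.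

(** Here [g] stands for either extra factor, the logarithmic or the power one. Since sigma q =
    (m-1)/m and p_k >= k+2, the q-th power of the weight is at most (k+2)^(-(m-1)/m) g_k^(-q), and
    the last hypothesis turns g_k^(-q) into the required D / ln (k+2). *)
Lemma scaled_power_sub_mon (g : nat -> R) (D : R) :
  (forall k, 0 < g k) -> (forall k l, (k <= l)%N -> g k <= g l) ->
  (forall k, ln k.+2%:R <= D * g k `^ q) ->
  scaled (fun k => 1 / ((p k)%:R `^ sigma * g k)) (ell r) `<=` mon r m.
Proof.
move=> g0 g_mono gD; have q0 := conjugate_exponent_gt0.
have mR : 0 < m%:R :> R by rewrite ltr0n.
have mE : m%:R - 1 = m.-1%:R :> R by rewrite -subn1 natrB.
have sigma0 : 0 <= sigma.
  rewrite mE mul1r mulr_ge0 ?divr_ge0//.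
  by rewrite -[leRHS]invrK invr_ge0 ltW.
have ps0 k : 0 < (p k)%:R `^ sigma by rewrite powR_gt0 ?p_gt0.
apply: (@scaled_ell_sub_mon _ _ _ _ D) => // [k|k l kl|k].
- by rewrite divr_ge0// mulr_ge0// ltW.
- rewrite [leLHS]div1r [leRHS]div1r lef_pV2 ?posrE ?mulr_gt0//.
  rewrite ler_pM ?(ltW (ps0 _)) ?(ltW (g0 _)) ?g_mono//.
  by rewrite ge0_ler_powR ?nnegrE ?ler_p.
have gq : 0 < g k `^ q by rewrite powR_gt0.
set x := k.+2%:R `^ _; have x0 : 0 < x by rewrite powR_gt0.
have lk : 0 < ln k.+2%:R :> R by exact: ln2D_gt0.
have px : x ^+ m.-1 <= ((p k)%:R `^ sigma) `^ q.
  have -> : ((p k)%:R `^ sigma) `^ q = ((p k)%:R `^ m%:R^-1) ^+ m.-1.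
    rewrite -[RHS](powR_mulrn _ (powR_ge0 _ _)) -!powRrM; congr (_ `^ _).
    rewrite mE div1r mulfK 1?mulrC//.
    by move: q0; rewrite invr_gt0 => /gt_eqF ->.
  rewrite lerXn2r ?nnegrE ?powR_ge0//.
  by rewrite ge0_ler_powR ?nnegrE ?invr_ge0 ?le_add2_p.
rewrite [X in X `^ q]div1r -powR_inv1 ?mulr_ge0 ?powR_ge0 ?(ltW (g0 k))//.
rewrite powRAC powR_inv1 ?powR_ge0// powRM ?powR_ge0 ?(ltW (g0 k))//.
rewrite ler_pdivlMr// ler_pdivlMr ?exprn_gt0// -mulrA mulrC.
rewrite ler_pdivrMr ?mulr_gt0 ?powR_gt0 ?p_gt0// [leRHS]mulrCA [leLHS]mulrC.
by rewrite ler_pM ?exprn_ge0 ?(ltW lk) ?(ltW x0).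
Qed.

End PowerWeights.

Theorem theorem5p3 (R : realType) (r : R) (m : nat) (p : nat -> nat)
    (r_gt1 : 1 < r) (r_lt2 : r < 2) (m_ge1 : (1 <= m)%N)
    (p_incr : {homo p : k l / (k < l)%N})
    (p_primes : forall q : nat, prime q <-> exists k, p k = q) :
  let sigma_m : R := (m%:R - 1) / m%:R * (1 - 1 / r) in
  (forall epsilon : R, 1 / r < epsilon ->
     scaled (fun k => 1 / ((p k)%:R `^ sigma_m * ln (p k)%:R `^ epsilon)) (ell r)
       `<=` mon r m)
  /\
  (forall epsilon : R, 0 < epsilon ->
     scaled (fun k => 1 / (p k)%:R `^ (sigma_m + epsilon)) (ell r)
       `<=` mon r m).
Proof.
move=> sigma_m; have r0 : 0 < r by apply: lt_trans r_gt1.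
have p0 : (2 <= p 0)%N by apply/prime_gt1/p_primes; exists 0%N.
have q0 := conjugate_exponent_gt0 r_gt1; set q := (1 - r^-1)^-1 in q0.
have lnp0 k : 0 < ln (p k)%:R :> R.
  by apply: lt_le_trans (ln_le_ln_p R p_incr p0 k); exact: ln2D_gt0.
split=> epsilon eps.
  have eps0 : 0 < epsilon by apply: lt_trans eps; rewrite divr_gt0.
  (* As r < 2, epsilon > 1/r > 1/2 > 1 - 1/r = 1/q. *)
  have s1 : 1 <= epsilon * q.
    rewrite /q ler_pdivlMr ?mul1r; last by rewrite -invr_gt0.
    apply: le_trans (ltW eps); rewrite div1r lerBlDr.
    have : 2^-1 < r^-1 by rewrite ltf_pV2 ?posrE.
    lra.
  (* Since ln 2 < 1, comparing L = ln p_k with its power L^(epsilon q) requires normalizing: L / ln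
     2 >= 1 is at most its own power, and [D] collects the powers of ln 2. *)
  pose l2 : R := ln 2; have l20 : 0 < l2 by exact: ln2D_gt0 0%N.
  apply: (scaled_power_sub_mon r_gt1 m_ge1 p_incr p0
      (g := fun k => ln (p k)%:R `^ epsilon) (D := l2 / l2 `^ (epsilon * q))).
  - by move=> k; rewrite powR_gt0.
  - move=> k l kl; rewrite ge0_ler_powR ?nnegrE ?(ltW eps0) ?(ltW (lnp0 _))//.
    by rewrite ler_ln ?posrE ?p_gt0// ler_p.
  - move=> k; apply: le_trans (ln_le_ln_p R p_incr p0 k) _; rewrite -powRrM -/q.
    set L := ln _; have L0 : 0 < L by exact: lnp0.
    have Ll : 1 <= L / l2.
      rewrite ler_pdivlMr// mul1r; apply: le_trans (ln_le_ln_p R p_incr p0 k).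
      by rewrite ler_ln ?posrE// ler_nat.
    have {1 2}-> : L = l2 * (L / l2) by rewrite mulrCA mulfV ?mulr1// gt_eqF.
    rewrite powRM ?(ltW l20) ?(le_trans _ Ll)// [leRHS]mulrA divfK ?gt_eqF ?powR_gt0//.
    by rewrite ler_wpM2l ?(ltW l20)// le1r_powR.
have eq0 : 0 < epsilon * q by rewrite mulr_gt0.
have -> : (fun k => 1 / (p k)%:R `^ (sigma_m + epsilon)) =
    (fun k => 1 / ((p k)%:R `^ sigma_m * (p k)%:R `^ epsilon)).
  apply/funext => k; rewrite powRD//; apply/implyP => _.
  by rewrite gt_eqF// (p_gt0 R p_incr p0).
(* With s = epsilon q, the constant 1/s comes from s ln x = ln (x^s) < x^s. *)
apply: (scaled_power_sub_mon r_gt1 m_ge1 p_incr p0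
    (g := fun k => (p k)%:R `^ epsilon) (D := (epsilon * q)^-1)).
- by move=> k; rewrite powR_gt0 ?p_gt0.
- by move=> k l kl; rewrite ge0_ler_powR ?nnegrE ?(ltW eps) ?ler_p.
- move=> k; apply: le_trans (ln_le_ln_p R p_incr p0 k) _.
  rewrite -powRrM -/q mulrC ler_pdivlMr// mulrC -ln_powR ltW// ln_sublinear//.
  by rewrite powR_gt0 ?p_gt0.
Qed.
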